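(* Let $\varphi(v)=v|v|^{p-2}$ with $p>1$, let $n$ be the space dimension, and denote $$\bar\alpha=\frac{p}{2(p-1)},\qquad \beta=\frac{1}{\bar\alpha}(\bar\alpha-1)=\frac{-p+2}{p},\qquad \gamma=\beta(p-1)=3-p-\frac{2}{p},$$ $$a=\bar\alpha^{\,p},\qquad A=\bar\alpha^{\,p}\gamma+(n-1)\bar\alpha^{\,p-1}.$$ Consider the problem in the variable $r$ $$(\mathrm{P}_r)\qquad \varphi(u'(r))'+\frac{n-1}{r}\,\varphi(u'(r))+f(u)=0,\qquad u(0)=\alpha>0,\ u'(0)=0,$$ and the problem in the variable $z$ $$(\mathrm{P}_z)\qquad a\,u''(z)+\frac{A}{(p-1)z}\,u'(z)+\frac{z^{p-2}}{\varphi'(u'(z))}\,f(u)=0,\qquad u(0)=\alpha,\ u'(0)=0.$$ Then, for $p>2$, the change of variables $z^2=r^{\frac{p}{p-1}}$ transforms $(\mathrm{P}_r)$ into $(\mathrm{P}_z)$. Conversely, if the solution of $(\mathrm{P}_z)$ is of the form $u=v(z^2)$, with $v(t)\in C^1([0,\infty))$, then the same change of variables transforms $(\mathrm{P}_z)$ into $(\mathrm{P}_r)$, for any $p>1$.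
   Context: The problem $(\mathrm{P}_r)$ is satisfied by radial solutions $u=u(r)$, $r=|x|$, of the $p$-Laplace equation $\mathrm{div}(|\nabla u|^{p-2}\nabla u)+f(u)=0$ in $\mathbb{R}^n$, with initial data prescribed at $r=0$. Here $f$ is a given function of $u$, and $\varphi'(v)=(p-1)|v|^{p-2}$. The change of variables $z^2=r^{\frac{p}{p-1}}$ means $z=r^{\bar\alpha}$, with $u$ regarded as a function of $z$ instead of $r$.
   Formalization: (P_z) is imposed only where φ'(u'(z)) is finite and nonzero, being undefined elsewhere; in the converse the remaining points z>0 are assumed isolated, with f continuous at u(z), since constant u would otherwise be a counterexample. *)

(* Defs.v *)
From HB Require Import structures.
From mathcomp Require Import all_boot all_order all_algebra.
From mathcomp Require Import all_classical all_reals all_analysis.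

Set Implicit Arguments.
Unset Strict Implicit.
Unset Printing Implicit Defensive.

Import Order.TTheory GRing.Theory Num.Theory.
Import numFieldNormedType.Exports.

Local Open Scope ring_scope.
Local Open Scope classical_set_scope.

Section constants.
Context {R : realType}.

Definition abar (p : R) : R := p / (2 * (p - 1)).
Definition beta (p : R) : R := (abar p)^-1 * (abar p - 1).
Definition gamma (p : R) : R := beta p * (p - 1).
Definition coef_a (p : R) : R := abar p `^ p.
Definition coef_A (n : nat) (p : R) : R := abar p `^ p * gamma p + (n%:R - 1) * abar p `^ (p - 1).

Definition phi (p v : R) : R := v * `|v| `^ (p - 2).

(* Since [0 `^ s] is [0] for [s != 0] and [1] for [s = 0], [dphi 0] vanishes
   exactly when [p != 2].  For [1 < p < 2], where phi has an infinite
   derivative at 0, that value is a convention.  In all cases [dphi v != 0]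
   means that phi has a finite nonzero derivative at [v]. *)
Definition dphi (p v : R) : R := (p - 1) * `|v| `^ (p - 2).

End constants.

Section problems.
Context {R : realType}.

Definition is_right_derive0 (u : R -> R) (l : R) : Prop :=
  h^-1 * (u h - u 0) @[h --> 0^'+] --> l.

Definition C1_on (T : \bar R) (v : R -> R) : Prop :=
  exists dv : R -> R,
    [/\ is_right_derive0 v (dv 0),
        forall t : R, 0 < t -> (t%:E < T)%E -> is_derive t 1 v (dv t) &
        {within [set t : R | 0 <= t /\ (t%:E < T)%E], continuous dv}].

(* (P_r) on [0, rmax), where rmax may be +oo.  Only phi(u') is required to be
   differentiable: u'' need not exist where u' vanishes. *)
Definition solves_Pr (n : nat) (p : R) (f : R -> R) (alpha : R)
    (rmax : \bar R) (u : R -> R) : Prop :=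
  [/\ u 0 = alpha,
      is_right_derive0 u 0,
      forall r : R, 0 < r -> (r%:E < rmax)%E -> derivable u r 1 &
      forall r : R, 0 < r -> (r%:E < rmax)%E ->
        derivable (fun s => phi p (derive1 u s)) r 1 /\
        derive1 (fun s => phi p (derive1 u s)) r
          + (n%:R - 1) / r * phi p (derive1 u r) + f (u r) = 0].

(* (P_z) on [0, zmax).  The equation divides by phi'(u'(z)), so it is imposed
   at the points where this quantity is finite and nonzero. *)
Definition solves_Pz (n : nat) (p : R) (f : R -> R) (alpha : R)
    (zmax : \bar R) (u : R -> R) : Prop :=
  [/\ u 0 = alpha,
      is_right_derive0 u 0,
      forall z : R, 0 < z -> (z%:E < zmax)%E -> derivable u z 1 &
      forall z : R, 0 < z -> (z%:E < zmax)%E -> dphi p (derive1 u z) != 0 ->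
        derivable (derive1 u) z 1 /\
        coef_a p * derive1 (derive1 u) z
          + coef_A n p / ((p - 1) * z) * derive1 u z
          + z `^ (p - 2) / dphi p (derive1 u z) * f (u z) = 0].

(* The points where (P_z) is meaningless along u are at most isolated, and f is
   continuous at the values taken there.  Without this, a constant would satisfy
   (P_z) vacuously for p != 2, whatever f is.  The condition holds trivially
   when u' does not vanish on (0, zmax), and always when p = 2. *)
Definition isolated_degeneracy (p : R) (f : R -> R)
    (zmax : \bar R) (u : R -> R) : Prop :=
  forall z : R, 0 < z -> (z%:E < zmax)%E -> dphi p (derive1 u z) = 0 ->
    {for u z, continuous f} /\
    (\forall y \near z^', dphi p (derive1 u y) != 0).

(* U is u regarded as a function of z, where z^2 = r^(p/(p-1)), and [0, zmax)
   is the image of [0, rmax). *)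
Definition change_of_variables (p : R) (rmax zmax : \bar R)
    (u U : R -> R) : Prop :=
  [/\ (0 < rmax)%E, (0 < zmax)%E,
      (zmax ^+ 2 = rmax `^ (p / (p - 1)))%E &
      forall r z : R, 0 <= r -> (r%:E < rmax)%E -> 0 <= z ->
        z ^+ 2 = r `^ (p / (p - 1)) -> U z = u r].

End problems.

(* Main.v *)
(* With [k = abar p] and [z = r^k], the chain rule gives
   [u'(r) = k r^(k-1) U'(z)].  As [phi p] is multiplicative, [phi(u'(r))] is
   [phi(U'(z))] times a constant multiple of a power of [r], and the product rule
   turns the left-hand side of (P_r) into that of (P_z) times
   [z^(2-p) phi'(U'(z))].  For p > 2 we have [1/k > 1], so [U'(0) = 0] follows
   from the differentiability of [u] at [0]; when [U = v(z^2)], the relation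
   [u = v(r^(p/(p-1)))] gives [u'(0) = 0] in the same way for all p > 1.
   At an isolated zero of [phi'(U')], (P_r) holds in a punctured neighbourhood
   and expresses the derivative of the continuous function [phi(u')] as a
   function continuous at the point, so (P_r) holds there too. *)
Require Import Defs.
From HB Require Import structures.
From mathcomp Require Import all_boot all_order all_algebra.
From mathcomp Require Import all_classical all_reals all_analysis.
From mathcomp Require Import ring lra.

Import Order.TTheory GRing.Theory Num.Theory.
Import numFieldNormedType.Exports.

Local Open Scope ring_scope.
Local Open Scope classical_set_scope.

(** * Derivatives at exceptional points and at the origin, and bounds that may be infinite *)

Section real_analysis.
Context {R : realType}.
Implicit Types (g dg : R -> R) (x l : R) (T : \bar R).

Lemma is_derive_continuous {g x l} : is_derive x 1 g l -> {for x, continuous g}.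
Proof.
by case=> dg _; apply: differentiable_continuous; apply/derivable1_diffP.
Qed.

(* L'Hopital's rule applied to the difference quotient of [g] at [x]. *)
Lemma is_derive1_punctured g dg x :
  {for x, continuous g} -> {for x, continuous dg} ->
  (\forall y \near x^', is_derive (y : R) 1 g (dg y)) ->
  is_derive x 1 g (dg x).
Proof.
move=> cg cdg; rewrite near_withinE => /nbhs_ballP[e /= e0 eg].
have xI : x \in `]x - e, x + e[%R by rewrite in_itv/=; lra.
have dgI (y : R) : y \in `]x - e, x + e[%classic `\ x -> is_derive y 1 g (dg y).
  rewrite inE/= in_itv/= => -[/andP[xy1 xy2] yx].
  apply: eg; last exact/eqP.
  by rewrite /ball/= ltr_distlC xy1 xy2.
have slope : (g y - g x) / (y - x) @[y --> x^'] --> dg x.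
  apply: (@lhopital R (fun y => g y - g x) dg (fun y => y - x) (cst 1)
    (x - e) (x + e) x) => //.
  - move=> y /dgI dgy; apply: is_derive_eq.
    by rewrite subr0.
  - move=> y _; apply: is_derive_eq.
    by rewrite subr0.
  - by rewrite -(subrr (g x)); apply: cvgB => //; exact: cvg_cst.
  - by rewrite -(subrr x); apply: cvgB => //; exact: cvg_cst.
  - by move=> y _; exact: oner_neq0.
  - by under eq_fun do rewrite divr1.
suff H : h^-1 *: (g (h *: 1 + x) - g x) @[h --> 0^'] --> dg x.
  split; first by apply/cvg_ex; exists (dg x).
  exact: cvg_lim.
(* Translation by [x] carries the limit over [y] to one over the increment [h]. *)
have shift : (h + x) @[h --> 0^'] --> x^'.
  move=> P /nbhs_ballP[d /= d0 dP]; apply/nbhs_ballP; exists d => //= h.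
  rewrite /ball/= sub0r normrN => hd h0; apply: dP; last by rewrite -subr_eq0 addrK.
  by rewrite /ball/= opprD addrCA subrr addr0 normrN.
apply: cvg_trans (cvg_comp _ _ shift slope).
apply: near_eq_cvg; near=> h => /=.
by rewrite addrK mulrC /GRing.scale/= mulr1.
Unshelve. all: by end_near. Qed.

Lemma near_lt_ereal x T : (x%:E < T)%E ->
  \forall y \near x, (y%:E < T)%E.
Proof.
case: T => [t| |]//; last by move=> _; apply: (@filterE _ (nbhs x)) => y; rewrite ltry.
by rewrite lte_fin => /lt_nbhsl; apply: filterS => y; rewrite lte_fin.
Qed.

Lemma near_itv_ereal {x T} : 0 < x -> (x%:E < T)%E ->
  \forall y \near x, 0 < y /\ (y%:E < T)%E.
Proof.
move=> x0 xT; near=> y; split; last by near: y; exact: near_lt_ereal.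
by rewrite -oppr_lt0; near: y; apply: Nlt_nbhsl; rewrite oppr_lt0.
Unshelve. all: by end_near. Qed.

(** Injectivity of the power map keeps [s^c] distinct from [r^c] when [s != r]. This pulls isolated
    degeneracy back from [z] to [r]. *)
Lemma near_dnbhs_powR {c r : R} {P : R -> Prop} : 0 < c -> 0 < r ->
  (\forall y \near (r `^ c)^', P y) -> \forall s \near r^', P (s `^ c).
Proof.
move=> c0 r0; rewrite !near_withinE => Pr.
have cr := is_derive_continuous (is_derive1_powR c r0).
near=> s => sr.
have s0 : 0 < s by near: s; apply: filterS (near_itv_ereal r0 (ltry r)) => ? [].
have : s `^ c != r `^ c -> P (s `^ c) by near: s; exact: cr Pr.
by apply; apply: contra_neq sr; apply: powR_injective => //; rewrite nnegrE ltW.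
Unshelve. all: by end_near. Qed.

(* [h ^ c = o(h)] at [0] when [c > 1]. *)
Lemma right_derive0_powR (c : R) {l : R} {w W : R -> R} : 1 < c ->
  is_right_derive0 w l -> W 0 = w 0 ->
  (\forall h \near 0^'+, W h = w (h `^ c)) ->
  is_right_derive0 W 0.
Proof.
move=> c1 dw W0 Ww; have c0 : 0 < c by lra.
have c10 : 0 < c - 1 by lra.
have shift : h `^ c @[h --> 0^'+] --> (0 : R)^'+.
  move=> P [d /= d0 dP].
  suff : \forall h \near (0 : R)^'+, P (h `^ c) by [].
  near=> h.
  have h0 : 0 < h by near: h; exact: nbhs_right_gt.
  have hc : 0 < h `^ c by rewrite powR_gt0.
  apply: dP => //=; rewrite sub0r normrN gtr0_norm//.
  by near: h; exact: (cvgr_lt 0 (powR_cvg0 c0)).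
(* The difference quotient of [W] at [h] is that of [w] at [h^c] times [h^(c-1)], and this last
   factor tends to 0. *)
have := cvgM (cvg_comp _ _ shift dw) (powR_cvg0 c10).
rewrite mulr0 /is_right_derive0 => H; apply: (cvg_trans _ (H _)).
apply: near_eq_cvg; near=> h => /=.
have h0 : 0 < h by near: h; exact: nbhs_right_gt.
have -> : W h = w (h `^ c) by near: h.
rewrite W0 powRB ?powRr1 ?ltW//; last by rewrite (gt_eqF h0) implybT.
by field; rewrite !gt_eqF// powR_gt0.
Unshelve. all: by end_near. Qed.

(** A point [t] with [0 < t < T] is interior to [[0, T)], so relative continuity there is ordinary
    continuity. *)
Lemma continuous_within_itv_ereal T g (t : R) :
  {within [set s : R | 0 <= s /\ (s%:E < T)%E], continuous g} ->
  0 < t -> (t%:E < T)%E -> {for t, continuous g}.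
Proof.
move=> /subspace_continuousP cg t0 tT P /(cg t (conj (ltW t0) tT)).
move=> H; apply: filterS2 (near_itv_ereal t0 tT) H => s [s0 sT]; apply.
by split=> //; exact: ltW.
Qed.

Lemma lte_sqr (z : R) T : 0 <= z -> (z%:E < T)%E ->
  ((z ^+ 2)%:E < T ^+ 2)%E.
Proof.
move=> z0; case: T => [t| |]//=; last by rewrite mulyy !ltry.
rewrite -EFinM !lte_fin => zt; have t0 := le_lt_trans z0 zt.
by rewrite -expr2 ltr_pXn2r// nnegrE ltW.
Qed.

End real_analysis.

(** * The odd power [phi], its inverse, derivative and continuity *)

Section phi.
Context {R : realType}.
Implicit Types p v c x y : R.

Lemma phiM p x y : phi p (x * y) = phi p x * phi p y.
Proof. by rewrite /phi normrM powRM // mulrACA. Qed.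

Lemma phiN p v : phi p (- v) = - phi p v.
Proof. by rewrite /phi normrN mulNr. Qed.

Lemma phi_gt0E p c : 0 < c -> phi p c = c `^ (p - 1).
Proof.
move=> c0; rewrite /phi gtr0_norm// -{1}(powRr1 (ltW c0)) -powRD.
  by congr (_ `^ _); ring.
by rewrite (gt_eqF c0) implybT.
Qed.

Lemma phi0 p : phi p 0 = 0.
Proof. by rewrite /phi mul0r. Qed.

Lemma norm_phi p v : 1 < p -> `|phi p v| = `|v| `^ (p - 1).
Proof.
move=> p1; have [->|v0] := eqVneq v 0.
  by rewrite phi0 normr0 powR0// subr_eq0 gt_eqF.
rewrite -phi_gt0E ?normr_gt0// /phi normr_id normrM; congr (_ * _).
by rewrite ger0_norm// powR_ge0.
Qed.

(** The conjugate exponent gives the inverse: [(p-1)(p/(p-1) - 2) = 2 - p] cancels the factor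
    [|v|^(p-2)]. *)
Lemma phi_conjugate p v : 1 < p -> phi (p / (p - 1)) (phi p v) = v.
Proof.
move=> p1; have [->|v0] := eqVneq v 0; first by rewrite !phi0.
have p10 : p - 1 != 0 by rewrite subr_eq0 gt_eqF.
rewrite {1}/phi norm_phi// /phi -powRrM -mulrA -powRD; last first.
  by rewrite normr_eq0 v0 implybT.
have -> : p - 2 + (p - 1) * (p / (p - 1) - 2) = 0 by field.
by rewrite powRr0 mulr1.
Qed.

(** As [0^s] is 0 unless [s = 0], [dphi p 0] can be nonzero only for [p = 2]. *)
Lemma dphi_neq0 {p v} : 1 < p -> dphi p v != 0 -> p = 2 \/ v != 0.
Proof.
move=> p1; rewrite /dphi mulf_eq0 subr_eq0 (gt_eqF p1)/= powR_eq0 normr_eq0.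
rewrite negb_and negbK subr_eq0 => /orP[->|/eqP ->]; [by right|by left].
Qed.

Lemma dphi_eq0 {p v} : 1 < p -> dphi p v = 0 -> v = 0.
Proof.
move=> p1 /eqP; rewrite /dphi mulf_eq0 subr_eq0 (gt_eqF p1)/=.
by rewrite powR_eq0 normr_eq0 => /andP[/eqP].
Qed.

(** Used to factor [dphi] out of the first-order terms, in which only [phi] appears. *)
Lemma phi_dphi p v : p != 1 -> phi p v = v * dphi p v / (p - 1).
Proof.
move=> p1; have p10 : p - 1 != 0 by rewrite subr_eq0.
by rewrite /phi /dphi; field.
Qed.

Lemma is_derive_phi_neq0 p v : v != 0 -> is_derive v 1 (phi p) (dphi p v).
Proof.
have pos (w : R) : 0 < w -> is_derive w 1 (phi p) (dphi p w).
  move=> w0; apply: (@near_eq_is_derive _ _ _ (fun y => y `^ (p - 1))).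
    by near=> y; rewrite phi_gt0E//; near: y; exact: (cvgr_gt w cvg_id).
  apply: is_derive_eq; first exact: is_derive1_powR.
  by rewrite /dphi gtr0_norm//; congr (_ * _ `^ _); ring.
rewrite neq_lt => /orP[v0|]; last exact: pos.
have nv0 : 0 < - v by rewrite oppr_gt0.
(* Oddness of [phi] reduces negative [v] to the positive case. *)
have -> : phi p = (- (phi p \o -%R)).
  by apply/funext => y; rewrite -{1}(opprK y) phiN.
apply: is_derive_eq.
  apply: is_deriveN; apply: is_derive1_comp; exact: pos.
by rewrite mulrN1 opprK /dphi normrN.
Unshelve. all: by end_near. Qed.

(** Beyond [v != 0], the only new case is [p = 2], where [phi] is the identity. *)
Lemma is_derive_phi p v : 1 < p -> dphi p v != 0 ->
  is_derive v 1 (phi p) (dphi p v).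
Proof.
move=> p1 /dphi_neq0 -/(_ p1)[->|]; last exact: is_derive_phi_neq0.
have -> : phi 2 = @id R.
  by apply/funext => y; rewrite /phi subrr powRr0 mulr1.
apply: is_derive_eq.
by rewrite /dphi subrr powRr0; ring.
Qed.

Lemma continuous_phi p : 1 < p -> continuous (phi p).
Proof.
move=> p1 v; have [->|v0] := eqVneq v 0; last first.
  exact: is_derive_continuous (is_derive_phi_neq0 p v v0).
have p10 : 0 < p - 1 by rewrite subr_gt0.
apply/cvgrPdist_lt => e e0; near=> y; rewrite phi0 sub0r normrN norm_phi//.
(* Since [|phi p y| = |y|^(p-1)], the radius [e^(1/(p-1))] at 0 yields the bound [e]. *)
have -> : e = (e `^ (p - 1)^-1) `^ (p - 1).
  by rewrite -powRrM mulVf ?gt_eqF// powRr1 ?ltW.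
apply: (gt0_ltr_powR p10); rewrite ?nnegrE ?powR_ge0//.
near: y; apply/nbhs_ballP; exists (e `^ (p - 1)^-1) => /=; first exact: powR_gt0.
by move=> y; rewrite /ball/= sub0r normrN.
Unshelve. all: by end_near. Qed.

End phi.

(** * Chain rule for the radial operator *)

Section change.
Context {R : realType}.
Implicit Types (u U : R -> R) (p r : R).

Lemma abar_gt0 {p} : 1 < p -> 0 < abar p.
Proof. by move=> p1; rewrite divr_gt0 ?mulr_gt0//; lra. Qed.

(** With [k = abar p], both sides are [r^(p(k-1))], because [k(2-p) = p(k-1)]. *)
Lemma powR_abar p r : 1 < p -> 0 < r ->
  (r `^ abar p) `^ (2 - p) = r `^ ((abar p - 1) * (p - 1)) * r `^ (abar p - 1).
Proof.
move=> p1 r0; have p10 : p - 1 != 0 by rewrite subr_eq0 gt_eqF.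
rewrite -powRrM -powRD; last by rewrite (gt_eqF r0) implybT.
by congr (_ `^ _); rewrite /abar; field.
Qed.

Lemma plaplacian_change (n : nat) {p u U r} : 1 < p -> 0 < r ->
  (\forall s \near r,
     derive1 u s = derive1 U (s `^ abar p) * (abar p * s `^ (abar p - 1))) ->
  derivable (derive1 U) (r `^ abar p) 1 -> dphi p (derive1 U (r `^ abar p)) != 0 ->
  let z := r `^ abar p in
  derivable (fun s => phi p (derive1 u s)) r 1 /\
  derive1 (fun s => phi p (derive1 u s)) r + ((n%:R - 1) / r) * phi p (derive1 u r) =
  z `^ (2 - p) * dphi p (derive1 U z) *
  (coef_a p * derive1 (derive1 U) z + coef_A n p / ((p - 1) * z) * derive1 U z).
Proof.
move=> p1 r0 uU dU' d0 z.
have p10 : p - 1 != 0 by rewrite subr_eq0 gt_eqF.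
have k0 := abar_gt0 p1.
set k := abar p in k0 z uU dU' d0 *.
have phiu' (s : R) : 0 < s -> derive1 u s = derive1 U (s `^ k) * (k * s `^ (k - 1)) ->
    phi p (derive1 u s) =
    phi p (derive1 U (s `^ k)) * (k `^ (p - 1) * s `^ ((k - 1) * (p - 1))).
  move=> s0 ->; rewrite phiM; congr (_ * _).
  rewrite phi_gt0E; last by rewrite mulr_gt0 ?powR_gt0.
  by rewrite powRM ?powR_ge0 ?(ltW k0)// -powRrM.
have zk := is_derive1_powR k r0.
have := is_derive1_powR ((k - 1) * (p - 1)) r0.
set E := fun s : R => s `^ ((k - 1) * (p - 1)) => dE.
have EV : E r / r = r `^ ((k - 1) * (p - 1) - 1).
  rewrite [RHS]powRB; last by rewrite (gt_eqF r0) implybT.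
  by rewrite powRr1 ?ltW.
have dphiU : is_derive r 1 (phi p \o (derive1 U \o (fun s => s `^ k)))
    (dphi p (derive1 U z) * (derive1 (derive1 U) z * (k * r `^ (k - 1)))).
  apply: is_derive1_comp; first exact: is_derive_phi.
  apply: is_derive1_comp; first by rewrite derive1E; exact: derivableP.
have dg : is_derive r 1 (fun s => phi p (derive1 u s))
    (phi p (derive1 U z) * (k `^ (p - 1) * ((k - 1) * (p - 1) * (E r / r))) +
     k `^ (p - 1) * E r * (dphi p (derive1 U z) * (derive1 (derive1 U) z * (k * r `^ (k - 1))))).
  (* The factored form of [phi(u')] holds near [r], not only at [r], so it may be differentiated in
     its place. *)
  apply: (@near_eq_is_derive _ _ _
    ((phi p \o (derive1 U \o (fun s => s `^ k))) * (k `^ (p - 1) *: E))).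
    near=> s; rewrite phiu'//; last by near: s.
    by near: s; exact: (cvgr_gt r cvg_id).
  apply: is_derive_eq.
  by rewrite EV.
split; first by case: dg.
rewrite derive1E (@derive_val _ _ _ _ _ _ _ dg) phiu'//; last exact: (nbhs_singleton uU).
(* Once every power is expressed through [r], [r^(k-1)], [E r] and [k^(p-1)], the claimed identity
   is rational and [field] decides it. *)
rewrite -/z -/(E r) powR_abar// -/k -/(E r).
have zE : z = r `^ (k - 1) * r.
  rewrite /z powRB; last by rewrite (gt_eqF r0) implybT.
  by rewrite powRr1 ?ltW// divfK// gt_eqF.
have kE : k `^ p = k * k `^ (p - 1).
  rewrite powRB; last by rewrite (gt_eqF k0) implybT.
  by rewrite powRr1 ?ltW// mulrC divfK// gt_eqF.
rewrite /coef_a /coef_A /gamma /beta -/k kE phi_dphi ?gt_eqF// zE.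
field.
by rewrite p10 !gt_eqF// powR_gt0.
Unshelve. all: by end_near. Qed.
End change.

(** * Correspondence between the variables [r] and [z] *)

Section change_of_variables.
Context {R : realType}.
Context {p : R} {rmax zmax : \bar R} {u U : R -> R}.
Context (p1 : 1 < p) (cov : change_of_variables p rmax zmax u U).
Local Notation k := (abar p).
Implicit Types r s z : R.

Let k0 : 0 < k := abar_gt0 p1.

Lemma sqr_powR_abar r : (r `^ k) ^+ 2 = r `^ (p / (p - 1)).
Proof.
rewrite -powR_mulrn ?powR_ge0// -powRrM; congr (_ `^ _).
have p10 : p - 1 != 0 by rewrite subr_eq0 gt_eqF.
by rewrite /abar; field.
Qed.

Lemma powR_abarVK z : 0 <= z -> (z `^ k^-1) `^ k = z.
Proof. by move=> z0; rewrite -powRrM mulVf ?gt_eqF// powRr1. Qed.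

(** Comparing squares through [zmax^2 = rmax^(p/(p-1))] reduces this to monotonicity of a power. The
    same relation forces the two bounds to be infinite together. *)
Lemma cov_lt {r} : 0 <= r -> ((r `^ k)%:E < zmax)%E = (r%:E < rmax)%E.
Proof.
move=> r0; case: cov => rm0 zm0 zmE _; move: rm0 zm0 zmE.
have q0 : 0 < p / (p - 1) by rewrite divr_gt0 ?subr_gt0// (lt_trans ltr01 p1).
case: rmax => [rm| |]; case: zmax => [zm| |]//=; rewrite ?(gt_eqF q0)//; last first.
  by rewrite !ltry.
rewrite !lte_fin => rm0 zm0 [] /esym zmE.
have -> : (r `^ k < zm) = ((r `^ k) ^+ 2 < zm ^+ 2).
  by rewrite ltr_pXn2r// nnegrE ?powR_ge0// ltW.
rewrite sqr_powR_abar expr2 -zmE; apply/idP/idP.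
  apply: contraLR; rewrite -!leNgt => rmr.
  by apply: ge0_ler_powR => //; rewrite ?nnegrE ltW.
by apply: (gt0_ltr_powR q0) => //; rewrite nnegrE ltW.
Qed.

Lemma covE {r} : 0 <= r -> (r%:E < rmax)%E -> U (r `^ k) = u r.
Proof.
by move=> r0 rm; case: cov => _ _ _; apply => //; rewrite ?powR_ge0 ?sqr_powR_abar.
Qed.

(** [u] and [U] are related only inside the intervals. Near an interior point [u] agrees with a
    composite to which the chain rule applies. *)
Lemma cov_is_derive {r} : 0 < r -> (r%:E < rmax)%E -> derivable U (r `^ k) 1 ->
  is_derive r 1 u (derive1 U (r `^ k) * (k * r `^ (k - 1))).
Proof.
move=> r0 rm dU; apply: (@near_eq_is_derive _ _ _ (U \o (fun s => s `^ k))).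
  near=> s; have [s0 sm] : 0 < s /\ (s%:E < rmax)%E.
    by near: s; exact: near_itv_ereal.
  by rewrite /= covE// ltW.
apply: is_derive1_comp; last exact: is_derive1_powR.
by rewrite derive1E; exact: derivableP.
Unshelve. all: by end_near. Qed.

Lemma cov_lt_inv {z} : 0 <= z -> (z%:E < zmax)%E -> ((z `^ k^-1)%:E < rmax)%E.
Proof. by move=> z0; rewrite -cov_lt ?powR_ge0// powR_abarVK. Qed.

Lemma cov_is_derive_inv {z} : 0 < z -> (z%:E < zmax)%E ->
  derivable u (z `^ k^-1) 1 ->
  is_derive z 1 U (derive1 u (z `^ k^-1) * (k^-1 * z `^ (k^-1 - 1))).
Proof.
move=> z0 zm du; apply: (@near_eq_is_derive _ _ _ (u \o (fun y => y `^ k^-1))).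
  near=> y; have [y0 ym] : 0 < y /\ (y%:E < zmax)%E.
    by near: y; exact: near_itv_ereal.
  by rewrite /= -covE ?powR_ge0 ?cov_lt_inv ?powR_abarVK ?ltW.
apply: is_derive1_comp; last exact: is_derive1_powR.
by rewrite derive1E; exact: derivableP.
Unshelve. all: by end_near. Qed.

Lemma cov0 : U 0 = u 0.
Proof.
by rewrite -{1}(powR0 (lt0r_neq0 k0)) covE//; case: cov.
Qed.

End change_of_variables.

(** * Equivalence of the two equations and transfer of solutions *)

Section transform.
Context {R : realType}.
Context (n : nat) {p : R} (alpha : R) (f : R -> R).
Context {rmax zmax : \bar R} {u U : R -> R}.
Context (p1 : 1 < p) (cov : change_of_variables p rmax zmax u U).
Local Notation k := (abar p).
Implicit Types r s z : R.

Let k0 : 0 < k := abar_gt0 p1.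

(* [u'] is recovered from the differentiable function [phi p (u')] through the
   inverse [phi (p / (p - 1))] of [phi p], smooth away from [0]. *)
Lemma derivable_derive1_inv {z} : 0 < z -> (z%:E < zmax)%E ->
  (forall r, 0 < r -> (r%:E < rmax)%E -> derivable u r 1) ->
  derivable (fun s => phi p (derive1 u s)) (z `^ k^-1) 1 ->
  derive1 U z != 0 -> derivable (derive1 U) z 1.
Proof.
move=> z0 zm du dphiu U'0; set r := z `^ k^-1.
have U'E y : 0 < y -> (y%:E < zmax)%E ->
    derive1 U y = derive1 u (y `^ k^-1) * (k^-1 * y `^ (k^-1 - 1)).
  move=> y0 ym; rewrite derive1E.
  apply: (@derive_val _ _ _ _ _ _ _ (cov_is_derive_inv p1 cov y0 ym _)).
  by apply: du; [exact: powR_gt0|exact: (cov_lt_inv p1 cov (ltW y0))].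
(* Inverting [phi], a zero of [phi(u')] would be a zero of [u'], hence of [U']. So the inverse is
   differentiated away from 0. *)
have phi0 : phi p (derive1 u r) != 0.
  apply: contra_neq U'0 => phi0; rewrite U'E//.
  by rewrite -(phi_conjugate p (derive1 u _))// phi0 /phi !mul0r.
(* This function is [U'] with [u'] rewritten as the inverse of [phi] applied to [phi(u')];
   differentiability of [u'] itself is not assumed. *)
have : is_derive z 1
    ((phi (p / (p - 1)) \o ((fun s => phi p (derive1 u s)) \o (fun y => y `^ k^-1)))
     * (k^-1 *: (fun y => y `^ (k^-1 - 1))))
    (phi (p / (p - 1)) (phi p (derive1 u r)) *:
       (k^-1 *: ((k^-1 - 1) * z `^ (k^-1 - 1 - 1))) +
     (k^-1 * z `^ (k^-1 - 1)) *: (dphi (p / (p - 1)) (phi p (derive1 u r)) *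
       (derive1 (fun s => phi p (derive1 u s)) r * (k^-1 * z `^ (k^-1 - 1))))).
  apply: is_deriveM.
    apply: is_derive1_comp; first exact: is_derive_phi_neq0.
    apply: is_derive1_comp; last exact: is_derive1_powR.
    by rewrite derive1E; exact: derivableP.
  by apply: is_deriveZ; exact: is_derive1_powR.
move=> /(@ex_derive _ _ _ _ _ _ _); apply: near_eq_derivable.
near=> y; have [y0 ym] : 0 < y /\ (y%:E < zmax)%E.
  by near: y; exact: near_itv_ereal.
by rewrite U'E// -[in RHS](phi_conjugate p (derive1 u _)).
Unshelve. all: by end_near. Qed.

(** The left-hand side of (P_r) is that of (P_z) times [z^(2-p) phi'(U'(z))], which is nonzero
    here. *)
Lemma cov_plaplacian {r} : 0 < r -> (r%:E < rmax)%E ->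
  (forall z, 0 < z -> (z%:E < zmax)%E -> derivable U z 1) ->
  derivable (derive1 U) (r `^ k) 1 -> dphi p (derive1 U (r `^ k)) != 0 ->
  let z := r `^ k in
  derivable (fun s => phi p (derive1 u s)) r 1 /\
  (derive1 (fun s => phi p (derive1 u s)) r
      + (n%:R - 1) / r * phi p (derive1 u r) + f (u r) = 0 <->
   coef_a p * derive1 (derive1 U) z
          + coef_A n p / ((p - 1) * z) * derive1 U z
          + z `^ (p - 2) / dphi p (derive1 U z) * f (U z) = 0).
Proof.
move=> r0 rm dU dU' d0 z.
have u'E : \forall s \near r,
    derive1 u s = derive1 U (s `^ abar p) * (abar p * s `^ (abar p - 1)).
  near=> s; have [s0 sm] : 0 < s /\ (s%:E < rmax)%E.
    by near: s; exact: near_itv_ereal.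
  rewrite derive1E.
  apply: (@derive_val _ _ _ _ _ _ _ (cov_is_derive p1 cov s0 sm _)).
  by apply: dU; rewrite ?powR_gt0// (cov_lt p1 cov (ltW s0)).
have [dg ->] := plaplacian_change n p1 r0 u'E dU' d0.
split=> //; rewrite -/z.
have -> : u r = U z by rewrite (covE p1 cov (ltW r0)).
have z0 : 0 < z by exact: powR_gt0.
rewrite -[p - 2]opprB powRN.
have Z0 : z `^ (2 - p) != 0 by rewrite gt_eqF// powR_gt0.
move: (z `^ (2 - p)) (dphi p (derive1 U z)) Z0 d0 => Z d Z0 d0.
set X := (X in Z * d * X); set F := f (U z).
have -> : X + Z^-1 / d * F = (Z * d * X + F) / (Z * d) by field; rewrite d0 Z0.
split=> [->|/eqP]; first by rewrite mul0r.
by rewrite mulf_eq0 invr_eq0 mulf_eq0 (negbTE Z0) (negbTE d0) !orbF => /eqP.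
Unshelve. all: by end_near. Qed.

(** The hypothesis [2 < p] enters twice: it gives [1/k = 2(p-1)/p > 1] for the condition at 0, and
    it makes [dphi != 0] imply [U' != 0], so that [U''] exists. *)
Lemma solves_Pr_Pz : 2 < p -> solves_Pr n p f alpha rmax u ->
  solves_Pz n p f alpha zmax U.
Proof.
move=> p2 [u0 du0 du eqr].
have dU z : 0 < z -> (z%:E < zmax)%E -> derivable U z 1.
  move=> z0 zm; have rm := cov_lt_inv p1 cov (ltW z0) zm.
  have dr := du _ (powR_gt0 _ z0) rm.
  by have [] := cov_is_derive_inv p1 cov z0 zm dr.
have U0 := cov0 p1 cov.
split=> //; first by rewrite U0.
  apply: (right_derive0_powR k^-1 _ du0 U0).
  - by rewrite /abar invf_div ltr_pdivlMr; lra.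
  - near=> h; have h0 : 0 < h by near: h; exact: nbhs_right_gt.
    rewrite -(covE p1 cov) ?powR_ge0 ?(powR_abarVK p1) ?ltW//.
    apply: (cov_lt_inv p1 cov (ltW h0)); near: h.
    apply: (@cvg_at_right_filter _ _ id 0 0 cvg_id).
    by apply: near_lt_ereal; case: cov.
move=> z z0 zm d0; set r := z `^ k^-1.
have r0 : 0 < r by exact: powR_gt0.
have rm : (r%:E < rmax)%E by exact: (cov_lt_inv p1 cov (ltW z0)).
have [dg er] := eqr r r0 rm.
have U'0 : derive1 U z != 0.
  by have [p2E|//] := dphi_neq0 p1 d0; rewrite p2E ltxx in p2.
have dU' := derivable_derive1_inv z0 zm du dg U'0.
have zE : z = r `^ k by rewrite powR_abarVK// ltW.
split=> //; move: dU' d0; rewrite zE => dU' d0.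
by have [_ [+ _]] := cov_plaplacian r0 rm dU dU' d0; apply.
Unshelve. all: by end_near. Qed.

(** Pointwise equivalence settles the points where [phi'(U')] is nonzero. The form [v(z^2)] supplies
    the condition at 0 and the continuity of [u'] needed at the other points. *)
Lemma solves_Pz_Pr (v : R -> R) : solves_Pz n p f alpha zmax U ->
  isolated_degeneracy p f zmax U -> C1_on (zmax ^+ 2)%E v ->
  (forall z : R, 0 <= z -> (z%:E < zmax)%E -> U z = v (z ^+ 2)) ->
  solves_Pr n p f alpha rmax u.
Proof.
move=> [U0a dU0 dU eqz] iso [dv [dv0 dvE cdv]] Uv.
have U0 := cov0 p1 cov.
have [rm0 zm0 _ _] := cov.
have kz r : 0 < r -> (r%:E < rmax)%E -> ((r `^ k)%:E < zmax)%E.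
  by move=> r0 rm; rewrite (cov_lt p1 cov (ltW r0)).
have du r (r0 : 0 < r) (rm : (r%:E < rmax)%E) :=
  cov_is_derive p1 cov r0 rm (dU _ (powR_gt0 _ r0) (kz r r0 rm)).
have U'E z : 0 < z -> (z%:E < zmax)%E -> derive1 U z = dv (z ^+ 2) * (z *+ 2).
  move=> z0 zm.
  suff H : is_derive z 1 U (dv (z ^+ 2) * (z *+ 2)).
    by rewrite derive1E (@derive_val _ _ _ _ _ _ _ H).
  apply: (@near_eq_is_derive _ _ _ (v \o (fun y => y ^+ 2))).
    near=> y; have [y0 ym] : 0 < y /\ (y%:E < zmax)%E.
      by near: y; exact: near_itv_ereal.
    by rewrite /= -Uv// ltW.
  apply: is_derive1_comp.
    by apply: dvE; [rewrite exprn_gt0|apply: lte_sqr => //; exact: ltW].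
  by apply: is_derive_eq; rewrite /GRing.scale/= mulr1 mulr2n.
(* The chain rule writes [u'] through [dv] and powers of [r], so continuity of [dv] passes to
   [u']. *)
have cu' r : 0 < r -> (r%:E < rmax)%E -> {for r, continuous (derive1 u)}.
  move=> r0 rm; have z0 := powR_gt0 k r0; have zm := kz r r0 rm.
  have ck (c : R) := is_derive_continuous (is_derive1_powR c r0).
  have H : dv ((s `^ k) ^+ 2) * (s `^ k *+ 2) * (k * s `^ (k - 1)) @[s --> r] -->
      dv ((r `^ k) ^+ 2) * (r `^ k *+ 2) * (k * r `^ (k - 1)).
    apply: cvgM; last by apply: cvgM; [exact: cvg_cst|exact: ck].
    apply: cvgM; last by apply: cvgMn; exact: ck.
    apply: (cvg_comp (fun s => (s `^ k) ^+ 2) dv).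
      exact: (continuous_comp (ck k) (@exprn_continuous _ 2 _)).
    apply: (continuous_within_itv_ereal _ _ _ cdv); first by rewrite exprn_gt0.
    by apply: lte_sqr => //; exact: ltW.
  have u'E s : 0 < s -> (s%:E < rmax)%E -> derive1 u s =
      dv ((s `^ k) ^+ 2) * (s `^ k *+ 2) * (k * s `^ (k - 1)).
    move=> s0 sm; rewrite derive1E (@derive_val _ _ _ _ _ _ _ (du s s0 sm)).
    by rewrite U'E ?powR_gt0// kz.
  suff : derive1 u s @[s --> r] --> derive1 u r by [].
  rewrite [X in _ --> X]u'E//; apply: (cvg_trans _ H); apply: near_eq_cvg.
  near=> s; have [s0 sm] : 0 < s /\ (s%:E < rmax)%E.
    by near: s; exact: near_itv_ereal.
  by rewrite u'E.
have step r : 0 < r -> (r%:E < rmax)%E -> dphi p (derive1 U (r `^ k)) != 0 ->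
    derivable (fun s => phi p (derive1 u s)) r 1 /\
    derive1 (fun s => phi p (derive1 u s)) r
      + (n%:R - 1) / r * phi p (derive1 u r) + f (u r) = 0.
  move=> r0 rm d0; have [dU' ez] := eqz _ (powR_gt0 k r0) (kz r r0 rm) d0.
  by have [dg [_ er]] := cov_plaplacian r0 rm dU dU' d0; split=> //; exact: er.
split.
- by rewrite -U0.
(* Near 0, [u(h) = v(h^(p/(p-1)))], and this exponent exceeds 1 for every [p > 1]. *)
- apply: (right_derive0_powR (p / (p - 1)) _ dv0).
  + by rewrite ltr_pdivlMr ?subr_gt0 // mul1r ltrBlDr ltrDl.
  + by rewrite -U0 Uv// expr0n.
  + near=> h; have h0 : 0 < h by near: h; exact: nbhs_right_gt.
    have hm : (h%:E < rmax)%E.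
      near: h; apply: (@cvg_at_right_filter _ _ id 0 0 cvg_id).
      exact: near_lt_ereal.
    by rewrite -(sqr_powR_abar p1) -Uv ?powR_ge0 ?kz// (covE p1 cov) ?ltW.
- by move=> r r0 rm; case: (du r r0 rm).
move=> r r0 rm; have [d0|] := eqVneq (dphi p (derive1 U (r `^ k))) 0; last exact: step.
have [cf iso0] := iso _ (powR_gt0 k r0) (kz r r0 rm) d0.
have u'0 : derive1 u r = 0.
  rewrite derive1E (@derive_val _ _ _ _ _ _ _ (du r r0 rm)).
  by rewrite (dphi_eq0 p1 d0) mul0r.
have cg : {for r, continuous (fun s => phi p (derive1 u s))}.
  by apply: continuous_comp; [exact: cu'|exact: continuous_phi].
(* The value that (P_r) prescribes for the derivative of [phi(u')]. It is continuous at [r] because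
   [iso] makes [f] continuous at [u r]. *)
pose dg s := - ((n%:R - 1) / s * phi p (derive1 u s) + f (u s)).
have cdg : {for r, continuous dg}.
  apply: cvgN; apply: cvgD.
    apply: cvgM; last exact: cg.
    by apply: cvgM; [exact: cvg_cst|apply: cvgV; [rewrite gt_eqF|exact: cvg_id]].
  apply: (continuous_comp (is_derive_continuous (du r r0 rm))).
  by rewrite -(covE p1 cov (ltW r0) rm).
have H : is_derive r 1 (fun s => phi p (derive1 u s)) (dg r).
  apply: is_derive1_punctured => //.
  (* On a punctured neighbourhood of [r] the degeneracy is absent, so [step] gives (P_r) there. *)
  have ds := near_dnbhs_powR k0 r0 iso0.
  near=> s; have [s0 sm] : 0 < s /\ (s%:E < rmax)%E.
    by near: s; apply: nbhs_dnbhs; exact: near_itv_ereal.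
  have [dgs es] : derivable (fun s => phi p (derive1 u s)) s 1 /\
    derive1 (fun s => phi p (derive1 u s)) s
      + (n%:R - 1) / s * phi p (derive1 u s) + f (u s) = 0.
    by apply: step => //; near: s.
  apply: DeriveDef => //; rewrite -derive1E.
  by apply/eqP; rewrite -subr_eq0 opprK addrA es.
split; first by case: H.
by rewrite derive1E (@derive_val _ _ _ _ _ _ _ H) /dg; ring.
Unshelve. all: by end_near. Qed.

End transform.

Theorem lemma1p1 (R : realType) (n : nat) (p alpha : R) (f : R -> R)
    (hn : (0 < n)%N) (hp : 1 < p) (halpha : 0 < alpha) :
  [/\ beta p = (- p + 2) / p,
      gamma p = 3 - p - 2 / p,
      2 < p ->
        forall (rmax zmax : \bar R) (u U : R -> R),
          change_of_variables p rmax zmax u U ->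
          solves_Pr n p f alpha rmax u ->
          solves_Pz n p f alpha zmax U &
      forall (rmax zmax : \bar R) (u U v : R -> R),
        change_of_variables p rmax zmax u U ->
        solves_Pz n p f alpha zmax U ->
        isolated_degeneracy p f zmax U ->
        C1_on (zmax ^+ 2)%E v ->
        (forall z : R, 0 <= z -> (z%:E < zmax)%E -> U z = v (z ^+ 2)) ->
        solves_Pr n p f alpha rmax u].
Proof.
have p0 : p != 0 by rewrite gt_eqF// (lt_trans ltr01 hp).
have p10 : p - 1 != 0 by rewrite subr_eq0 gt_eqF.
split.
- by rewrite /beta /abar; field; rewrite p0 p10.
- by rewrite /gamma /beta /abar; field; rewrite p0 p10.
- move=> p2 rmax zmax u U cov.
  exact: (solves_Pr_Pz n alpha f hp cov p2).
- move=> rmax zmax u U v cov.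
  exact: (solves_Pz_Pr n alpha f hp cov v).
Qed.
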